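(* Let $g:\mathbb C\to\mathbb C$ be the map defined in the context and assume $\nu^2\lambda>2L$. Let $V\subset\mathbb C$ be a connected set with positive two-dimensional Lebesgue measure. Then there is $n\in\mathbb N$ such that $g^n(V)$ intersects the real axis.
   Context: Let $L\ge1$ and let $\mathfrak h=(\mathfrak h_1,\mathfrak h_2,\mathfrak h_3)$ be a sense-preserving $L$-bi-Lipschitz map (i.e. $|a-b|/L\le|\mathfrak h(a)-\mathfrak h(b)|\le L|a-b|$) of $Q=[-1,1]^2$ onto the closed upper unit hemisphere $\{x\in\mathbb R^3:|x|=1,x_3\ge0\}$, with $\partial Q$ mapped onto the equator, satisfying $\mathfrak h_1(t,t)=\mathfrak h_2(t,t)$ and $\mathfrak h_1(t,-t)=-\mathfrak h_2(t,-t)$ for $t\in[-1,1]$. Let $\lambda\ge1$, $\nu>0$. For $y\in[-\sqrt2,\sqrt2]$ put $a(y)=\mathfrak h_3(y/\sqrt2,y/\sqrt2)$ and $b(y)=\sqrt2\,\mathfrak h_1(y/\sqrt2,y/\sqrt2)$ (so $a^2+b^2=1$). Define $g:\mathbb C\to\mathbb C$ as follows: for $z=x+iy$ with $y\in[(4k-1)\sqrt2,(4k+1)\sqrt2]$, $k\in\mathbb Z$, let $g(z)=\nu e^{\lambda x}\big(a(y-4k\sqrt2)+i\,b(y-4k\sqrt2)\big)$; for $y\in[(4k+1)\sqrt2,(4k+3)\sqrt2]$ let $g(z)=g(\bar z+2\sqrt2 i)$. (This is the conjugate of the Zorich map $\mathcal Z_\nu$ restricted to the invariant plane $x_1=x_2$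 via $(x_1,x_1,x_3)\mapsto(x_3+i\sqrt2x_1)/\lambda$.) *)

(* Defs.v *)
(* The complex plane C is modelled as
   R * R (z = x + i y  <->  (x, y)); R^2 likewise as R * R; R^3 by three
   coordinate functions. *)
From HB Require Import structures.
From mathcomp Require Import all_boot all_order all_algebra.
From mathcomp Require Import all_classical all_reals all_analysis.
Set Implicit Arguments. Unset Strict Implicit. Unset Printing Implicit Defensive.
Import Order.TTheory GRing.Theory Num.Theory.
Import numFieldNormedType.Exports.
Local Open Scope classical_set_scope.
Local Open Scope ring_scope.

Section Zorich.
Variable R : realType.

Definition dist2 (p q : R * R) : R :=
  Num.sqrt ((p.1 - q.1) ^+ 2 + (p.2 - q.2) ^+ 2).
Definition dist3 (p q : R * R * R) : R :=
  Num.sqrt ((p.1.1 - q.1.1) ^+ 2 + (p.1.2 - q.1.2) ^+ 2 + (p.2 - q.2) ^+ 2).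

Definition Qsq : set (R * R) :=
  [set p | -1 <= p.1 <= 1 /\ -1 <= p.2 <= 1].
Definition bdQ : set (R * R) :=
  [set p | p \in Qsq /\ (`|p.1| = 1 \/ `|p.2| = 1)].

Definition hemisphere : set (R * R * R) :=
  [set x | x.1.1 ^+ 2 + x.1.2 ^+ 2 + x.2 ^+ 2 = 1 /\ 0 <= x.2].
Definition equator : set (R * R * R) :=
  [set x | x.1.1 ^+ 2 + x.1.2 ^+ 2 + x.2 ^+ 2 = 1 /\ x.2 = 0].

Definition hmap (h1 h2 h3 : R * R -> R) (p : R * R) : R * R * R :=
  (h1 p, h2 p, h3 p).

Definition bi_lipschitz_on (L : R) (A : set (R * R)) (f : R * R -> R * R * R) :=
  forall p q, A p -> A q ->
    dist2 p q / L <= dist3 (f p) (f q) <= L * dist2 p q.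

Definition leb2 := ((@lebesgue_measure R) \x (@lebesgue_measure R))%E.

(* Jacobian of h (on the sphere, with respect to the outward normal h(p)):
   det [ d_s h(p), d_t h(p), h(p) ] *)
Definition jac_sphere (h1 h2 h3 : R * R -> R) (p : R * R) : R :=
  let d f v := ('d f p : R * R -> R) v in
  let u1 := d h1 (1, 0) in let u2 := d h2 (1, 0) in let u3 := d h3 (1, 0) in
  let v1 := d h1 (0, 1) in let v2 := d h2 (0, 1) in let v3 := d h3 (0, 1) in
  h1 p * (u2 * v3 - u3 * v2) + h2 p * (u3 * v1 - u1 * v3)
    + h3 p * (u1 * v2 - u2 * v1).

(* sense-preserving (orientation preserving, Q with its standard orientation,
   the hemisphere oriented by the outward normal): a.e. on Q, h is
   differentiable with positive Jacobian *)
Definition sense_preserving (h1 h2 h3 : R * R -> R) :=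
  {ae leb2, forall p, Qsq p ->
     [/\ differentiable h1 p, differentiable h2 p, differentiable h3 p
       & 0 < jac_sphere h1 h2 h3 p]}.

Definition admissible_h (L : R) (h1 h2 h3 : R * R -> R) : Prop :=
  (1 <= L)
  /\ bi_lipschitz_on L Qsq (hmap h1 h2 h3)
  /\ hmap h1 h2 h3 @` Qsq = hemisphere
  /\ hmap h1 h2 h3 @` bdQ = equator
  /\ sense_preserving h1 h2 h3
  /\ (forall t : R, -1 <= t <= 1 ->
        h1 (t, t) = h2 (t, t) /\ h1 (t, - t) = - h2 (t, - t)).

Definition sq2 : R := Num.sqrt 2.

Definition za (h3 : R * R -> R) (y : R) : R := h3 (y / sq2, y / sq2).
Definition zb (h1 : R * R -> R) (y : R) : R := sq2 * h1 (y / sq2, y / sq2).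

(* The map g.  For y, let k = floor((y/sqrt2 + 1)/4) and u = y - 4 k sqrt2,
   so u \in [-sqrt2, 3 sqrt2).  If u <= sqrt2 then y is in the strip
   [(4k-1)sqrt2, (4k+1)sqrt2] and g(x+iy) = nu e^{lambda x}(a(u) + i b(u));
   otherwise y is in [(4k+1)sqrt2, (4k+3)sqrt2] and
   g(z) = g(conj z + 2 sqrt2 i) = nu e^{lambda x}(a(w) + i b(w)) with
   w = 2 sqrt2 - u. *)
Definition zorich_g (h1 h3 : R * R -> R) (lambda nu : R) (z : R * R) : R * R :=
  let x := z.1 in let y := z.2 in
  let k : R := (Num.floor ((y / sq2 + 1) / 4))%:~R in
  let u := y - 4 * k * sq2 in
  let w := if u <= sq2 then u else 2 * sq2 - u in
  (nu * expR (lambda * x) * za h3 w, nu * expR (lambda * x) * zb h1 w).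

(* V is Lebesgue measurable (in R^2) with positive measure: it is squeezed
   between two Borel sets differing by a null set, the inner one having
   positive measure. *)
Definition pos_leb2_measure (V : set (R * R)) :=
  exists A B : set (R * R), [/\ measurable A, measurable B,
    A `<=` V /\ V `<=` B, leb2 (B `\` A) = 0%E & (0 < leb2 A)%E].

End Zorich.

(* Main.v *)
(* In the half-plane Re >= 0, which contains every image of [g], the Jacobian of
   [g] is at least [lambda nu^2 / L > 2], because the arc [y |-> a + i b] has
   speed at least [1 / L].  If no image of [V] met the real axis, then, being
   connected and missing the lines [Im = 2 sqrt2 m], which [g] sends into the
   real axis, each [g^n V] would lie in a single strip of height [2 sqrt2], on
   which [g] is at most two-to-one.  So the area of [g^n V] would grow
   geometrically.  But points of a strip which [g] maps back into a strip form a
   set of uniformly bounded area.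
   The images of [V] need not be measurable, so areas are compared through
   preimages: [area (A & g^-n E) <= C q^n area E] with [q = 2 L / (lambda nu^2)]. *)
Require Import Defs.
From HB Require Import structures.
From mathcomp Require Import all_boot all_order all_algebra.
From mathcomp Require Import all_classical all_reals all_analysis.
From mathcomp Require Import measurable_realfun zify ring lra.
Import Order.TTheory GRing.Theory Num.Theory.
Import numFieldNormedType.Exports.
Local Open Scope classical_set_scope.
Local Open Scope ring_scope.

Local Notation leb := (@lebesgue_measure _).

(** * Comparison of one-dimensional outer measure with integrals of a density *)

(** [X] lies in [[inf X, inf X + d]], and monotonicity of the outer measure does the rest, so the
    bound also covers preimages whose measurability is not established. *)
Lemma lebesgue_diam_le {R : realType} (X : set R) (d : R) : 0 <= d ->
  (forall x y, X x -> X y -> `|x - y| <= d) ->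
  (leb X <= d%:E)%E.
Proof.
move=> d0 Xd.
have [->|/set0P[x0 Xx0]] := eqVneq X set0; first by rewrite measure0 lee_fin.
have XI : X `<=` `[inf X, inf X + d].
  have Xlb : has_lbound X.
    by exists (x0 - d) => y Xy; move: (Xd _ _ Xx0 Xy); rewrite ler_norml; lra.
  move=> y Xy /=; rewrite in_itv/= ge_inf//=.
  rewrite -lerBlDr; apply: lb_le_inf; first by exists x0.
  by move=> z Xz; move: (Xd _ _ Xz Xy); rewrite ler_norml; lra.
apply: le_trans (le_outer_measure (wlength idfun)^*%mu _ _ XI) _.
rewrite [leLHS](_ : _ = lebesgue_measure `[inf X, inf X + d]%classic)//.
rewrite lebesgue_measure_itv /= lte_fin; case: ifP => // _.
by rewrite -EFinB lee_fin; lra.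
Qed.

Lemma lebesgue_cover {R : realType} (B : set R) (e : R) : 0 < e ->
  (leb B < +oo)%E ->
  exists A : (set R)^nat, [/\ (forall k, ocitv (A k)), B `<=` \bigcup_k A k &
   (\sum_(0 <= k <oo) (leb (A k)) <= leb B + e%:E)%E].
Proof.
move=> e0 Boo.
have : leb B \is a fin_num.
  by rewrite ge0_fin_numE// outer_measure_ge0.
move/lb_ereal_inf_adherent => /(_ _ e0)[_/= [A [mA BA] <-] Ae].
exists A; split => //.
apply: le_trans (ltW Ae); apply: lee_nneseries => // n _.
rewrite -((measurable_mu_extE (wlength idfun)) (A n))//.
Qed.

(* Covering [B] by intervals of total length at most [leb B + e] only controls
   integrals of constants from above, so the bound is applied to [w] and to
   [M - w] simultaneously. *)
Lemma lebesgue_preimage_le_fin {R : realType} (T : R -> R) (D : set R)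
    (w : R -> R) (M : R) :
  measurable_fun setT w -> (forall t, 0 <= w t <= M) ->
  (forall p q, p < q -> (leb (D `&` T @^-1` `]p, q]) <=
     \int[leb]_(t in `]p, q]) (w t)%:E)%E) ->
  forall B : set R, measurable B -> (leb B < +oo)%E ->
    (leb (D `&` T @^-1` B) <=
       \int[leb]_(t in B) (w t)%:E)%E.
Proof.
move=> mw wM Hw B mB Boo.
have M0 : 0 <= M by have /andP[] := wM 0; exact: le_trans.
have mwE (S : set R) : measurable_fun S (EFin \o w).
  by apply/measurable_EFinP; exact: measurable_funS mw.
have mvE (S : set R) : measurable_fun S (EFin \o (fun t => M - w t)).
  apply/measurable_EFinP; apply: measurable_funS (_ : measurable_fun setT _) => //.
  exact: measurable_funB.
have w0 t : (0 <= (w t)%:E)%E by rewrite lee_fin; have /andP[] := wM t.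
have v0 t : (0 <= (M - w t)%:E)%E.
  by rewrite lee_fin subr_ge0; have /andP[] := wM t.
have wv (S : set R) : measurable S ->
    (\int[leb]_(t in S) (w t)%:E + \int[leb]_(t in S) (M - w t)%:E = M%:E * leb S)%E.
  move=> mS; rewrite -ge0_integralD//; last 2 first.
    exact: mwE.
    exact: mvE.
  under eq_integral do rewrite -EFinD addrC subrK.
  by rewrite integral_cst.
have vfin : (\int[leb]_(t in B) (M - w t)%:E)%E \is a fin_num.
  rewrite ge0_fin_numE; last exact: integral_ge0.
  apply: (@le_lt_trans _ _ (M%:E * leb B)%E).
    by rewrite -wv// leeDr// integral_ge0.
  by apply: lte_mul_pinfty.
(* Adding the finite integral of [M - w] turns the right side into [M * leb B], which a cover by
   intervals approximates from above. *)
rewrite -(@leeD2rE _ (\int[leb]_(t in B) (M - w t)%:E)%E)// wv//.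
apply/lee_addgt0Pr => e e0.
(* The excess of the cover is multiplied by [M] in the end; dividing by [M + 1] keeps it below [e]
   and allows [M = 0]. *)
have e1 : 0 < e / (M + 1) by rewrite divr_gt0// ltr_pwDr.
have [A [oA BA Ae]] := @lebesgue_cover R B _ e1 Boo.
have mA k : measurable (A k).
  by have [[p q] _ <-] := oA k; exact: measurable_itv.
have rhoA k : (leb (D `&` T @^-1` A k) <= \int[leb]_(t in A k) (w t)%:E)%E.
  have [->|[[p q] /= pq ->]] := (ocitvP (A k)).1 (oA k); last exact: Hw.
  rewrite preimage_set0 setI0 integral_set0 (_ : leb set0 = 0%E)//.
apply: (@le_trans _ _ (\sum_(0 <= k <oo) (\int[leb]_(t in A k) (w t)%:E) +
   \sum_(0 <= k <oo) (\int[leb]_(t in A k) (M - w t)%:E))%E).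
  apply: leeD.
    apply: (@le_trans _ _ (leb (\bigcup_k (D `&` T @^-1` A k)))).
      apply: (le_outer_measure (wlength idfun)^*%mu).
      by rewrite -setI_bigcupr => x [Dx Bx]; split => //; exact: BA.
    apply: le_trans (outer_measure_sigma_subadditive (wlength idfun)^*%mu _) _.
    by apply: lee_nneseries => [k _ _|k _]; [exact: outer_measure_ge0|exact: rhoA].
  apply: (@le_trans _ _ (\int[leb]_(t in \bigcup_k A k) (M - w t)%:E)%E).
    apply: ge0_subset_integral => //; [exact: bigcupT_measurable|exact: mvE].
  (* The covering intervals may overlap, so they are made disjoint before the integral over the
     union is split. *)
  have mS k : measurable (seqDU A k).
    by apply: measurableD => //; exact: bigsetU_measurable.
  rewrite seqDU_bigcup_eq ge0_integral_bigcup//; last exact: mvE.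
  apply: lee_nneseries => [k _ _|k _]; first by apply: integral_ge0 => t _; exact: v0.
  apply: ge0_subset_integral => //; last exact: subset_seqDU.
  - exact: mS.
  - exact: mA.
  - exact: mvE.
rewrite -nneseriesD; last 2 first.
- by move=> *; exact: integral_ge0.
- by move=> *; exact: integral_ge0.
rewrite (eq_eseriesr (g := fun k => (M%:E * leb (A k))%E)); last by move=> k _; exact: wv.
rewrite nneseriesZl//.
apply: (@le_trans _ _ (M%:E * (leb B + (e / (M + 1))%:E))%E).
  by apply: lee_wpmul2l.
rewrite ge0_muleDr; [|exact: outer_measure_ge0|by rewrite lee_fin ltW].
rewrite leeD2l// -EFinM lee_fin mulrA ler_pdivrMr; last by lra.
by rewrite mulrC ler_pM2l//; lra.
Qed.

(** A one-sided change of variables for a [T] without derivative: the density [w] is tested on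
    intervals only. By sigma-finiteness [B] is cut into disjoint pieces of finite measure; the left
    side is subadditive and the right side additive over them. *)
Lemma lebesgue_preimage_le {R : realType} (T : R -> R) (D : set R)
    (w : R -> R) (M : R) :
  measurable_fun setT w -> (forall t, 0 <= w t <= M) ->
  (forall p q, p < q -> (leb (D `&` T @^-1` `]p, q]) <=
     \int[leb]_(t in `]p, q]) (w t)%:E)%E) ->
  forall B : set R, measurable B ->
    (leb (D `&` T @^-1` B) <=
       \int[leb]_(t in B) (w t)%:E)%E.
Proof.
move=> mw wM Hw B mB.
have [F FT mF] := sigma_finiteT (@lebesgue_measure R).
have mS k : measurable (seqDU F k).
  apply: measurableD; first exact: (mF k).1.
  by apply: bigsetU_measurable => *; exact: (mF _).1.
have BE : B = \bigcup_k (B `&` seqDU F k).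
  by rewrite -setI_bigcupr -seqDU_bigcup_eq -FT setIT.
rewrite {1}BE.
apply: (@le_trans _ _ (leb (\bigcup_k (D `&` T @^-1` (B `&` seqDU F k))))).
  apply: (le_outer_measure (wlength idfun)^*%mu).
  by rewrite preimage_bigcup setI_bigcupr.
apply: le_trans (outer_measure_sigma_subadditive (wlength idfun)^*%mu _) _.
rewrite {2}BE ge0_integral_bigcup; last 4 first.
- by move=> k; exact: measurableI.
- by apply/measurable_EFinP; exact: measurable_funS mw.
- by move=> t _; rewrite lee_fin; have /andP[] := wM t.
- by apply: trivIset_setIl; exact: trivIset_seqDU.
apply: lee_nneseries => [k _ _|k _]; first exact: outer_measure_ge0.
apply: (@lebesgue_preimage_le_fin _ _ _ _ M) => //; first by apply: measurableI => //; exact: mS.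
apply: le_lt_trans (mF k).2.
by apply: (le_outer_measure (wlength idfun)^*%mu) => x [_ Sx]; exact: subset_seqDU Sx.
Qed.

Lemma integral_itvoc_derive {R : realType} (f F : R -> R) (p q : R) : p < q ->
  (forall x, p <= x <= q -> is_derive x 1 F (f x)) ->
  (forall x, p <= x <= q -> {for x, continuous f}) ->
  (\int[leb]_(t in `]p, q]) (f t)%:E = (F q - F p)%:E)%E.
Proof.
move=> pq dF cf.
have cfpq : {within `[p, q], continuous f}.
  by apply: continuous_in_subspaceT => x; rewrite inE/= in_itv/=; exact: cf.
have cF x : p <= x <= q -> {for x, continuous F}.
  move=> xpq; apply: differentiable_continuous; apply/derivable1_diffP.
  by have [] := dF _ xpq.
rewrite integral_itv_obnd_cbnd; last first.
  apply/measurable_EFinP.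
  apply: measurable_funS (_ : measurable_fun `[p, q]%classic f) => //.
    by apply: subset_itvr; rewrite bnd_simp.
  by apply: subspace_continuous_measurable_fun.
rewrite EFinB; apply: continuous_FTC2 => //.
- split.
  + move=> x; rewrite in_itv/= => /andP[px xq].
    by have [] : is_derive x 1 F (f x) by apply: dF; rewrite !ltW.
  + by apply: cvg_at_right_filter; apply: cF; rewrite lexx ltW.
  + by apply: cvg_at_left_filter; apply: cF; rewrite lexx ltW.
- move=> x; rewrite in_itv/= => /andP[px xq].
  have xpq : p <= x <= q by rewrite !ltW.
  by have dFx := dF _ xpq; rewrite derive1E derive_val.
Qed.

(** The comparison with constant density [u^-1]. It serves the substitution [v = u t] on a vertical
    line. *)
Lemma lebesgue_scale_le {R : realType} (u : R) (B : set R) : 0 < u ->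
  measurable B -> (u%:E * leb ((fun t : R => (u * t)%R) @^-1` B) <= leb B)%E.
Proof.
move=> u0 mB.
have Iu (S : set R) : measurable S ->
    (\int[leb]_(t in S) (cst u^-1 t)%:E = u^-1%:E * leb S)%E.
  by move=> mS; rewrite -integral_cst.
have H : (leb (setT `&` (fun t => (u * t)%R) @^-1` B) <=
    \int[leb]_(t in B) (cst u^-1 t)%:E)%E.
  apply: (@lebesgue_preimage_le _ _ _ _ u^-1) => //.
    by move=> t; rewrite /cst lexx andbT invr_ge0 ltW.
  move=> p q pq; rewrite Iu//= lebesgue_measure_itv/= lte_fin pq.
  rewrite -EFinB -EFinM; apply: lebesgue_diam_le.
    by rewrite mulr_ge0 ?invr_ge0 ?subr_ge0// ltW.
  move=> x y [_ /=] + [_ /=]; rewrite !in_itv/= => xI yI.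
  rewrite -(ler_pM2l u0) mulrA divff ?gt_eqF// mul1r -[X in X * `|_|]gtr0_norm//.
  by rewrite -normrM mulrBr ler_norml; lra.
rewrite setTI Iu// in H.
apply: (@le_trans _ _ (u%:E * ((u^-1)%:E * leb B))%E).
  by apply: lee_wpmul2l => //; rewrite lee_fin ltW.
by rewrite muleA -EFinM divff ?gt_eqF// mul1e.
Qed.

(** * Angles on the right half circle, and comparisons along arcs and rays *)

(** The squared chord is [2 - 2 cos (x - y) = 4 sin^2 ((x - y) / 2)], and [|sin z| <= |z|] by the
    mean value theorem. *)
Lemma chord_le_arc {R : realType} (x y : R) :
  (cos x - cos y) ^+ 2 + (sin x - sin y) ^+ 2 <= (x - y) ^+ 2.
Proof.
have sin_le (z : R) : 0 <= z -> `|sin z| <= z.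
  move=> z0.
  have [|c _ E] := @MVT_segment R sin cos 0 z z0 (fun x _ => is_derive_sin x).
    by apply: continuous_subspaceT => ?; exact: continuous_sin.
  rewrite sin0 !subr0 in E; rewrite E normrM [`|z|]ger0_norm// ler_piMl//.
  by rewrite ler_norml cos_geN1 cos_le1.
have sin2_le (z : R) : sin z ^+ 2 <= z ^+ 2.
  rewrite -(real_normK (num_real (sin z))) -(real_normK (num_real z)).
  rewrite ler_sqr ?nnegrE//; have [z0|z0] := leP 0 z; first by rewrite [leRHS]ger0_norm// sin_le.
  by rewrite -normrN -sinN ltr0_norm// sin_le// oppr_ge0 ltW.
have -> : (cos x - cos y) ^+ 2 + (sin x - sin y) ^+ 2 =
    (cos x ^+ 2 + sin x ^+ 2) + (cos y ^+ 2 + sin y ^+ 2)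
     - 2 * (cos x * cos y + sin x * sin y) by ring.
rewrite !cos2Dsin2 -cosB.
have -> : x - y = ((x - y) / 2) *+ 2 by rewrite mulr2n; lra.
set h := (x - y) / 2.
have := cos2Dsin2 h; have := sin2_le h; rewrite cos_mulr2n mulr2n; move: (cos h) (sin h) => c s.
by rewrite ?mulr2n; nra.
Qed.

Lemma sin_atan_mul {R : realType} (t : R) : sin (atan t) = t * cos (atan t).
Proof.
rewrite -{2}[t]atanK /tan mulfVK// gt_eqF// cos_gt0_pihalf//.
by rewrite atan_gtNpi2 atan_ltpi2.
Qed.

Lemma cos_atan_gt0 {R : realType} (t : R) : 0 < cos (atan t).
Proof. by rewrite cos_gt0_pihalf// atan_gtNpi2 atan_ltpi2. Qed.

Lemma cos_atan_sqr {R : realType} (t : R) : (1 + t ^+ 2) * cos (atan t) ^+ 2 = 1.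
Proof.
by rewrite -[RHS](cos2Dsin2 (atan t)) sin_atan_mul; ring.
Qed.

Lemma cos_atan_div {R : realType} (a b : R) : 0 < a -> a ^+ 2 + b ^+ 2 = 1 ->
  cos (atan (b / a)) = a /\ sin (atan (b / a)) = b.
Proof.
move=> a0 ab1.
have ca : cos (atan (b / a)) = a.
  apply/eqP; rewrite -(@eqrXn2 _ 2)// ?(ltW (cos_atan_gt0 _)) ?(ltW a0)//.
  have := cos_atan_sqr (b / a).
  have -> : 1 + (b / a) ^+ 2 = (a ^+ 2)^-1.
    by rewrite -[RHS]mul1r -{2}ab1; field; rewrite gt_eqF.
  move=> E; apply/eqP; rewrite -[RHS]mulr1 -E mulrA divff ?mul1r//.
  by rewrite sqrf_eq0 gt_eqF.
by rewrite sin_atan_mul ca mulfVK// gt_eqF.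
Qed.

Lemma le_lebesgue {R : realType} (A B : set R) : A `<=` B -> (leb A <= leb B)%E.
Proof. exact: (le_outer_measure (wlength idfun)^*%mu). Qed.

Lemma lebesgueU_le {R : realType} (A B : set R) :
  (leb (A `|` B) <= leb A + leb B)%E.
Proof. exact: (outer_measureU2 (wlength idfun)^*%mu). Qed.

Lemma measurable_oneDsqrV {R : realType} (K : R) :
  measurable_fun setT (fun t : R => K / (1 + t ^+ 2)).
Proof.
apply: continuous_measurable_fun => t; apply: cvgM; first exact: cvg_cst.
apply: cvgV; first by rewrite gt_eqF// ltr_pwDl// sqr_ge0.
by apply: cvgD; [exact: cvg_cst|exact: exprn_continuous].
Qed.

(* The points with [a = 0] are split off because there [b / a = 0] is a junk value. *)
Lemma arc_preimage_le {R : realType} (a b : R -> R) (D : set R) (K r : R)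
    (E : set (R * R)) : 0 <= K ->
  (forall y, D y -> 0 <= a y /\ a y ^+ 2 + b y ^+ 2 = 1) ->
  (forall y z, D y -> D z ->
     (y - z) ^+ 2 <= K ^+ 2 * ((a y - a z) ^+ 2 + (b y - b z) ^+ 2)) ->
  measurable E ->
  (leb (D `&` [set y | E (r * a y, r * b y)%R]) <=
   \int[leb]_(t in [set t : R | E (r * cos (atan t), r * sin (atan t))%R])
     (K / (1 + t ^+ 2))%:E)%E.
Proof.
move=> K0 ab1 Dab mE.
set B := [set t : R | E (r * cos _, _)].
have mB : measurable B.
  rewrite -[B]setTI.
  have mcs : measurable_fun setT
      (fun t : R => (r * cos (atan t), r * sin (atan t))).
    apply: measurable_fun_pair; apply: continuous_measurable_fun => t.
      apply: cvgM; first exact: cvg_cst.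
      by apply: continuous_comp; [exact: continuous_atan|exact: continuous_cos].
    apply: cvgM; first exact: cvg_cst.
    by apply: continuous_comp; [exact: continuous_atan|exact: continuous_sin].
  exact: mcs.
pose N s := D `&` [set y | a y = 0 /\ b y = s].
pose P := D `&` [set y | a y != 0].
pose T y := b y / a y.
(* Two points of [N s] have the same image under [(a, b)], so the expansion hypothesis makes them
   equal. *)
have null s : leb (N s) = 0%E.
  apply/eqP; rewrite eq_le outer_measure_ge0 andbT.
  apply: lebesgue_diam_le => // y z [Dy [ay by_]] [Dz [az bz]].
  have := Dab _ _ Dy Dz; rewrite ay az by_ bz !subrr expr0n/= addr0 mulr0.
  by rewrite exprn_even_le0//= => /eqP ->; rewrite normr0.
apply: (@le_trans _ _ (leb (P `&` T @^-1` B) + (leb (N 1%R) + leb (N (-1)%R)))%E).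
  apply: le_trans (leeD2l _ (lebesgueU_le _ _)).
  apply: le_trans (lebesgueU_le _ _).
  apply: le_lebesgue => y [Dy Ey].
  have [a0 ab] := ab1 _ Dy.
  have [ay|ay] := eqVneq (a y) 0.
    right; have : b y ^+ 2 == 1 by rewrite -ab ay expr0n/= add0r.
    by rewrite sqrf_eq1 => /orP[] /eqP; [left|right].
  left; split => //; rewrite /B/=.
  have ay0 : 0 < a y by rewrite lt_neqAle eq_sym ay.
  by have [-> ->] := cos_atan_div _ _ ay0 ab.
rewrite !null !adde0.
apply: (@lebesgue_preimage_le _ _ _ _ K) => //.
- exact: measurable_oneDsqrV.
- move=> t; have t0 : 1 <= 1 + t ^+ 2 by rewrite lerDl sqr_ge0.
  rewrite divr_ge0 ?(le_trans _ t0)//= ler_pdivrMr ?(lt_le_trans _ t0)//.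
  by rewrite ler_peMr.
- move=> p q pq.
  (* The integral of the density is [K] times the angle between slopes [p] and [q]. Distances in [D]
     are at most [K] times chords, hence at most [K] times angles. *)
  rewrite (@integral_itvoc_derive _ _ (fun t => K * atan t))//; last first.
    move=> t _; apply: cvgM; first exact: cvg_cst.
    apply: cvgV; first by rewrite gt_eqF// ltr_pwDl// sqr_ge0.
    by apply: cvgD; [exact: cvg_cst|exact: exprn_continuous].
  have apq := le_atan (ltW pq).
  apply: lebesgue_diam_le; first by rewrite -mulrBr mulr_ge0// subr_ge0.
  move=> y z [[Dy /= ay]] + [[Dz /= az]]; rewrite !in_itv/= => /andP[py yq] /andP[pz zq].
  have [a0 ab] := ab1 _ Dy; have [a0' ab'] := ab1 _ Dz.
  have ay0 : 0 < a y by rewrite lt_neqAle eq_sym ay.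
  have az0 : 0 < a z by rewrite lt_neqAle eq_sym az.
  have := chord_le_arc (atan (T y)) (atan (T z)).
  have [-> ->] := cos_atan_div _ _ ay0 ab.
  have [-> ->] := cos_atan_div _ _ az0 ab'.
  move=> /(ler_wpM2l (sqr_ge0 K)); move: (Dab _ _ Dy Dz) => /le_trans/[apply].
  rewrite -exprMn => /ler_wsqrtr; rewrite !sqrtr_sqr => /le_trans; apply.
  rewrite normrM ger0_norm// -mulrBr ler_wpM2l//.
  have := le_atan (ltW py); have := le_atan yq.
  have := le_atan (ltW pz); have := le_atan zq.
  by rewrite ler_norml; lra.
Qed.

(** On the ray of slope [t] put [u = nu e^(lambda x) cos (atan t)], so that [dx = du / (lambda u)].
    Since [u] is at least its value [u0] at [x0], [1 / (lambda u) <= u / (lambda u0^2)], a density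
    proportional to [u] as in the area element [u du dt]. *)
Lemma ray_preimage_le {R : realType} (nu lambda x0 t : R) (E : set (R * R)) :
  0 < nu -> 0 < lambda -> measurable E ->
  (leb (`[x0, +oo[ `&` [set x | E (nu * expR (lambda * x) * cos (atan t),
                                   nu * expR (lambda * x) * sin (atan t))%R]) <=
   \int[leb]_(u in [set u : R | (0 < u)%R /\ E (u, u * t)%R])
     ((1 + t ^+ 2) / (lambda * nu ^+ 2 * expR (lambda * x0) ^+ 2) * u)%:E)%E.
Proof.
move=> nu0 la0 mE.
set c := nu * cos (atan t).
have c0 : 0 < c by rewrite mulr_gt0// cos_atan_gt0.
set u0 := c * expR (lambda * x0).
have u00 : 0 < u0 by rewrite mulr_gt0// expR_gt0.
pose psi x := c * expR (lambda * x).
have psiE x : nu * expR (lambda * x) * cos (atan t) = psi x.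
  by rewrite /psi /c; ring.
have psi0 x : 0 < psi x by rewrite mulr_gt0// expR_gt0.
have psi_u0 x : x0 <= x -> u0 <= psi x.
  by move=> xx; rewrite ler_pM2l// ler_expR ler_pM2l.
set B' := [set u : R | 0 < u /\ _].
have mB' : measurable B'.
  have -> : B' = `]0, +oo[ `&` (fun u => (u, u * t)) @^-1` E.
    by apply/seteqP; split => u /=; rewrite in_itv/= andbT.
  apply: measurableI => //; rewrite -[X in measurable X]setTI.
  have mut : measurable_fun setT (fun u : R => (u, u * t)).
    apply: measurable_fun_pair => //; apply: continuous_measurable_fun => u.
    by apply: cvgM; [exact: cvg_id|exact: cvg_cst].
  exact: mut.
pose B := `[u0, +oo[ `&` B'.
have mB : measurable B by exact: measurableI.
(* Truncating at [u0] makes the density [1 / (lambda u)] continuous and bounded on the whole line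
   without changing it on [B]. *)
pose w u := (lambda * Num.max u0 u)^-1.
have max0 u : 0 < Num.max u0 u by rewrite lt_max u00.
have wcont : continuous w.
  move=> u; apply: cvgV; first by rewrite mulf_neq0 ?gt_eqF.
  apply: cvgM; first exact: cvg_cst.
  rewrite (_ : Num.max u0 = fun v => (u0 + v + `|u0 - v|) / 2); last first.
    by apply/funext => v; rewrite maxr_absE.
  apply: cvgM; last exact: cvg_cst.
  apply: cvgD; first by apply: cvgD; [exact: cvg_cst|exact: cvg_id].
  by apply: cvg_norm; apply: cvgB; [exact: cvg_cst|exact: cvg_id].
apply: (@le_trans _ _ (leb (`[x0, +oo[ `&` psi @^-1` B))).
  apply: le_lebesgue => x [] /=; rewrite in_itv/= andbT => xx Ex.
  split; first exact: xx.
  have B'x : B' (psi x).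
    split => //; move: Ex; rewrite sin_atan_mul psiE.
    by rewrite [_ * (t * _)]mulrCA psiE [t * _]mulrC.
  split; last exact: B'x.
  by rewrite /= in_itv/= andbT psi_u0.
apply: (@le_trans _ _ (\int[leb]_(u in B) (w u)%:E)%E).
  apply: (@lebesgue_preimage_le _ _ _ _ (lambda * u0)^-1) => //.
  - exact: continuous_measurable_fun.
  - move=> u; rewrite invr_ge0 mulr_ge0 ?(ltW (max0 _)) ?(ltW la0)//=.
    by rewrite /w lef_pV2 ?posrE ?(mulr_gt0 la0)// ler_pM2l// le_max lexx.
  - move=> p q pq.
    have w0 u : (0 <= (w u)%:E)%E.
      by rewrite lee_fin invr_ge0 mulr_ge0 ?(ltW (max0 _)) ?(ltW la0).
    (* If [q <= u0], only [x = x0] can have [psi x <= q]; otherwise the interval is cut at [u0],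
       above which [ln v / lambda] is a primitive of [w]. *)
    have [qu0|u0q] := leP q u0.
      apply: (@le_trans _ _ 0%E); last exact: integral_ge0.
      apply: lebesgue_diam_le => // x y [] /=; rewrite in_itv/= andbT => xx.
      rewrite !in_itv/= => /andP[_ xq] [] yx /andP[_ yq]; rewrite andbT in yx.
      have E1 z : x0 <= z -> psi z <= q -> z = x0.
        move=> xz zq; have := le_trans zq qu0; rewrite ler_pM2l// ler_expR ler_pM2l// => zx.
        by apply/eqP; rewrite eq_le zx xz.
      by rewrite (E1 x)// (E1 y)// subrr normr0.
    set p' := Num.max p u0.
    have p'q : p' < q by rewrite gt_max pq u0q.
    have p'0 : 0 < p' by rewrite lt_max u00 orbT.
    apply: (@le_trans _ _ (\int[leb]_(u in `]p', q]) (w u)%:E)%E); last first.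
      apply: ge0_subset_integral => //.
        by apply/measurable_EFinP; apply: measurable_funS (continuous_measurable_fun wcont).
      by apply: subset_itvr; rewrite bnd_simp le_max lexx.
    have max_id u : p' <= u -> Num.max u0 u = u.
      by rewrite ge_max => /andP[_ /max_idPr].
    have dw u : p' <= u <= q -> is_derive u 1 (fun v => lambda^-1 * ln v) (w u).
      move=> /andP[pu _]; rewrite /w max_id// invfM.
      by apply: is_deriveZ; apply: is_derive1_ln; exact: lt_le_trans pu.
    rewrite (integral_itvoc_derive _ _ _ _ p'q dw); last by move=> u _; exact: wcont.
    have lnpq : ln p' <= ln q by rewrite ler_ln ?posrE ?(ltW p'q)// (lt_trans p'0).
    have li0 : 0 <= lambda^-1 by rewrite invr_ge0 ltW.
    apply: lebesgue_diam_le; first by rewrite -mulrBr mulr_ge0// subr_ge0.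
    have lnpsi x : x0 <= x -> p < psi x <= q -> ln p' <= ln c + lambda * x <= ln q.
      move=> xx /andP[px xq].
      have <- : ln (psi x) = ln c + lambda * x.
        by rewrite lnM ?posrE ?expR_gt0// expRK.
      rewrite !ler_ln ?posrE//; last by rewrite (lt_trans p'0).
      by rewrite xq andbT ge_max (ltW px) psi_u0.
    move=> x y [] /=; rewrite in_itv/= andbT => xx; rewrite in_itv/= => xpq.
    move=> []; rewrite in_itv/= andbT => yx; rewrite in_itv/= => ypq.
    have := lnpsi _ xx xpq; have := lnpsi _ yx ypq => /andP[y1 y2] /andP[x1 x2].
    rewrite -mulrBr -(ler_pM2l la0) mulrA divff ?gt_eqF// mul1r.
    rewrite -[X in X * _](gtr0_norm la0) -normrM mulrBr ler_norml.
    by lra.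
set C := (1 + t ^+ 2) / (lambda * nu ^+ 2 * expR (lambda * x0) ^+ 2).
have C0 : 0 < C.
  by rewrite divr_gt0 ?mulr_gt0 ?exprn_gt0 ?expR_gt0 // ltr_pwDl// sqr_ge0.
have Cu0 : C * u0 ^+ 2 = lambda^-1.
  have e0 := expR_gt0 (lambda * x0).
  rewrite /C /u0 /c !exprMn.
  have := cos_atan_sqr t; move: (cos (atan t) ^+ 2) (1 + t ^+ 2) (expR (lambda * x0)) e0.
  move=> C2 T e e0 TC.
  have -> : T / (lambda * nu ^+ 2 * e ^+ 2) * (nu ^+ 2 * C2 * e ^+ 2) = (T * C2) / lambda.
    by field; rewrite !gt_eqF.
  by rewrite TC mul1r.
have mC (S : set R) : measurable_fun S (EFin \o (fun u => C * u)).
  apply/measurable_EFinP; apply: measurable_funS (_ : measurable_fun setT _) => //.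
  by apply: continuous_measurable_fun => u; apply: cvgM; [exact: cvg_cst|exact: cvg_id].
apply: (@le_trans _ _ (\int[leb]_(u in B) (C * u)%:E)%E).
  apply: ge0_le_integral => //.
  - by move=> u _; rewrite lee_fin invr_ge0 mulr_ge0 ?(ltW (max0 _)) ?(ltW la0).
  - by apply/measurable_EFinP; apply: measurable_funS (continuous_measurable_fun wcont).
  - exact: mC.
  - move=> u [] /=; rewrite in_itv/= andbT => uu _.
    have u_gt0 : 0 < u := lt_le_trans u00 uu.
    rewrite lee_fin /w (max_idPr uu) invfM -Cu0 ler_pdivrMr//.
    by rewrite -[C * u * u]mulrA (ler_pM2l C0) -expr2 ler_sqr ?nnegrE ?(ltW u00) ?(ltW u_gt0).
apply: ge0_subset_integral => //.
- exact: mC.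
- by move=> u [u1 _]; rewrite lee_fin mulr_ge0 ?(ltW C0) ?(ltW u1).
- by move=> u [].
Qed.

(** * Planar area in polar form *)

Lemma measurable_half_plane {R : realType} (x0 : R) :
  measurable [set z : R * R | x0 <= z.1].
Proof.
rewrite (_ : mkset _ = setT `&` fst @^-1` `[x0, +oo[); last first.
  by apply/seteqP; split => z /=; rewrite in_itv/= andbT => // -[].
by apply: measurable_fst.
Qed.

Lemma measurable_window {R : realType} (f : R * R -> R * R) (x0 : R) (D : set R)
    (E : set (R * R)) : measurable_fun setT f -> measurable D -> measurable E ->
  measurable [set z | [/\ x0 <= z.1, D z.2 & E (f z)]].
Proof.
move=> mf mD mE.
rewrite (_ : mkset _ = [set z | x0 <= z.1] `&`
    ((setT `&` snd @^-1` D) `&` (setT `&` f @^-1` E))); last first.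
  apply/seteqP; split => z /=; first by case.
  by move=> [? [[_ ?] [_ ?]]].
apply: measurableI; first exact: measurable_half_plane.
by apply: measurableI; [apply: measurable_snd|apply: mf].
Qed.

Lemma integral_patch_xsection {R : realType} (f : R * R -> \bar R)
    (E : set (R * R)) (x : R) :
  (\int[leb]_t (f \_ E) (x, t) = \int[leb]_(t in xsection E x) f (x, t))%E.
Proof.
rewrite [RHS]integral_mkcond; apply: eq_integral => t _.
by rewrite /patch mem_xsection.
Qed.

Lemma integral_patch_ysection {R : realType} (f : R * R -> \bar R)
    (E : set (R * R)) (t : R) :
  (\int[leb]_x (f \_ E) (x, t) = \int[leb]_(x in ysection E t) f (x, t))%E.
Proof.
rewrite [RHS]integral_mkcond; apply: eq_integral => x _.
by rewrite /patch mem_ysection.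
Qed.

(* In the coordinates [u = Re], [t = Im / Re] the planar area is [u du dt], so
   the area of an image in polar form is computed with one-dimensional
   comparisons only. *)
Lemma polar_contraction {R : realType} (a b : R -> R) (D : set R)
    (K nu lambda x0 : R) (E : set (R * R)) :
  0 <= K -> 0 < nu -> 0 < lambda ->
  (forall y, D y -> 0 <= a y /\ a y ^+ 2 + b y ^+ 2 = 1) ->
  (forall y z, D y -> D z ->
     (y - z) ^+ 2 <= K ^+ 2 * ((a y - a z) ^+ 2 + (b y - b z) ^+ 2)) ->
  measurable D -> measurable_fun setT a -> measurable_fun setT b ->
  measurable E ->
  (leb2 [set z | [/\ (x0 <= z.1)%R, D z.2 &
     E (nu * expR (lambda * z.1) * a z.2, nu * expR (lambda * z.1) * b z.2)%R]] <=
   (K / (lambda * nu ^+ 2 * expR (lambda * x0) ^+ 2))%:E * leb2 E)%E.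
Proof.
move=> K0 nu0 la0 ab1 Dab mD ma mb mE.
set X := [set z | _].
pose r x := nu * expR (lambda * x).
have mr : measurable_fun setT (fun z : R * R => r z.1).
  apply: (@measurableT_comp _ _ _ _ _ _ r); last exact: measurable_fst.
  by apply: measurable_funM => //; apply: measurableT_comp => //; exact: measurable_funM.
have mpair (f g : R -> R) : measurable_fun setT f -> measurable_fun setT g ->
    measurable_fun setT (fun z : R * R => (r z.1 * f z.2, r z.1 * g z.2)).
  move=> mf mg; apply: measurable_fun_pair; apply: measurable_funM => //.
    by apply: measurableT_comp => //; exact: measurable_snd.
  by apply: measurableT_comp => //; exact: measurable_snd.
have mX : measurable X.
  apply: (measurable_window (fun z => (r z.1 * a z.2, r z.1 * b z.2))) => //.
  exact: mpair.
(* [E'] is the pullback of [E] to the coordinates [(x, t)], with [t] the slope; [E''] below is its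
   pullback to [(u, t)]. *)
pose E' := [set z : R * R | x0 <= z.1] `&` [set z |
  E (r z.1 * cos (atan z.2), r z.1 * sin (atan z.2))].
have mE' : measurable E'.
  apply: measurableI; first exact: measurable_half_plane.
  rewrite -[X in measurable X]setTI.
  apply: (mpair (fun t => cos (atan t)) (fun t => sin (atan t))) => //;
    apply: continuous_measurable_fun => t.
    by apply: continuous_comp; [exact: continuous_atan|exact: continuous_cos].
  by apply: continuous_comp; [exact: continuous_atan|exact: continuous_sin].
pose E'' := [set z : R * R | 0 < z.1] `&` [set z | E (z.1, z.1 * z.2)].
have mE'' : measurable E''.
  apply: measurableI.
    rewrite (_ : mkset _ = setT `&` fst @^-1` `]0, +oo[); last first.
      by apply/seteqP; split => z /=; rewrite in_itv/= andbT => // -[].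
    by apply: measurable_fst.
  rewrite -[X in measurable X]setTI.
  have m1 : measurable_fun setT (fun z : R * R => (z.1, z.1 * z.2)).
    apply: measurable_fun_pair; first exact: measurable_fst.
    by apply: measurable_funM; [exact: measurable_fst|exact: measurable_snd].
  exact: m1.
set q := K / _.
have q0 : 0 <= q.
  by rewrite /q divr_ge0 ?mulr_ge0 ?sqr_ge0 ?(ltW la0) ?(ltW nu0).
pose w t := K / (1 + t ^+ 2).
have t0 t : 0 < 1 + t ^+ 2 :> R by rewrite ltr_pwDl// sqr_ge0.
have w0 t : 0 <= w t by rewrite divr_ge0// ltW.
pose G : R * R -> \bar R := (fun z => (w z.2)%:E) \_ E'.
pose H : R * R -> \bar R := (fun z => (q * z.1)%:E) \_ E''.
have mpatch (S : set (R * R)) (f : R * R -> R) : measurable S ->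
    measurable_fun setT f -> measurable_fun setT ((EFin \o f) \_ S).
  move=> mS mf; have [+ _] := measurable_restrict (EFin \o f) mS measurableT.
  by apply; apply: measurable_funTS; exact/measurable_EFinP.
have mG : measurable_fun setT G.
  apply: (mpatch E' (fun z => w z.2)) => //.
  apply: measurableT_comp; last exact: measurable_snd.
  exact: measurable_oneDsqrV.
have mH : measurable_fun setT H.
  apply: (mpatch E'' (fun z => q * z.1)) => //.
  by apply: measurable_funM => //; exact: measurable_fst.
have G0 z : (0 <= G z)%E by rewrite /G/patch; case: ifP => // _; rewrite lee_fin.
have H0 z : (0 <= H z)%E.
  rewrite /H/patch; case: ifP => //; rewrite inE => -[/= z1 _].
  by rewrite lee_fin mulr_ge0// ltW.
(* For fixed [x] the variable [y] is replaced by the slope [t], at the cost of the density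
   [K / (1 + t^2)]. *)
have H1 : (leb2 X <= \int[leb]_x \int[leb]_t G (x, t))%E.
  apply: ge0_le_integral => //.
  - exact: measurable_fun_xsection.
  - exact: (measurable_fun_fubini_tonelli_F (m2 := @lebesgue_measure R) G mG G0).
  - move=> x _ /=; rewrite integral_patch_xsection.
    have [xx|xx] := leP x0 x; last first.
      rewrite (_ : xsection X x = set0) ?measure0 ?integral_ge0//; last first.
        rewrite -subset0 => y; rewrite /xsection/= inE => -[/=].
        by rewrite leNgt xx.
      by move=> t _; rewrite lee_fin.
    have -> : xsection X x = D `&` [set y | E (r x * a y, r x * b y)].
      by apply/seteqP; split => y; rewrite /xsection/= inE => -[].
    have -> : xsection E' x =
        [set t | E (r x * cos (atan t), r x * sin (atan t))].
      apply/seteqP; split => y; rewrite /xsection/= inE; first by case.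
      by move=> ?; split.
    exact: arc_preimage_le.
apply: (le_trans H1).
rewrite (fubini_tonelli (m1 := @lebesgue_measure R) (m2 := @lebesgue_measure R) G mG G0).
(* With the order of integration exchanged, [x] is replaced by [u] for fixed [t]; the two factors
   [1 + t^2] cancel and leave the density [q u]. *)
have H2 : (\int[leb]_t \int[leb]_x G (x, t) <= \int[leb]_t \int[leb]_u H (u, t))%E.
  apply: ge0_le_integral => //.
  - by move=> t _; exact: integral_ge0.
  - exact: (measurable_fun_fubini_tonelli_G (m1 := @lebesgue_measure R) G mG G0).
  - exact: (measurable_fun_fubini_tonelli_G (m1 := @lebesgue_measure R) H mH H0).
  - move=> t _; rewrite !integral_patch_ysection.
    have mS : measurable (ysection E' t) by exact: measurable_ysection.
    have mS' : measurable (ysection E'' t) by exact: measurable_ysection.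
    rewrite [leLHS](_ : _ = (w t)%:E * leb (ysection E' t))%E; last first.
      by rewrite -integral_cst.
    have S1 : ysection E' t = `[x0, +oo[ `&` [set x | E (nu * expR (lambda * x) * cos (atan t),
                                   nu * expR (lambda * x) * sin (atan t))].
      by apply/seteqP; split => y; rewrite /ysection/= inE/= in_itv/= andbT.
    have S2 : ysection E'' t = [set u : R | 0 < u /\ E (u, u * t)].
      by apply/seteqP; split => y; rewrite /ysection/= inE.
    apply: (@le_trans _ _ ((w t)%:E * \int[leb]_(u in ysection E'' t)
      ((1 + t ^+ 2) / (lambda * nu ^+ 2 * expR (lambda * x0) ^+ 2) * u)%:E)%E).
      by apply: lee_wpmul2l; [rewrite lee_fin|rewrite S1 S2; exact: ray_preimage_le].
    rewrite -ge0_integralZl//.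
    + rewrite le_eqVlt; apply/orP; left; apply/eqP.
      apply: eq_integral => u _; rewrite -EFinM; congr (_%:E).
      rewrite /w /q mulrA; congr (_ * _).
      by rewrite mulrA mulfVK// gt_eqF.
    + apply/measurable_EFinP; apply: measurable_funTS.
      exact: measurable_funM.
    + move=> u; rewrite S2 => -[u0 _]; rewrite lee_fin mulr_ge0 ?(ltW u0)//.
      by rewrite divr_ge0 ?mulr_ge0 ?sqr_ge0 ?(ltW la0) ?(ltW nu0) ?(ltW (t0 _)).
    + by rewrite lee_fin.
apply: (le_trans H2).
rewrite -(fubini_tonelli (m1 := @lebesgue_measure R) (m2 := @lebesgue_measure R) H mH H0).
have -> : (q%:E * leb2 E = \int[leb]_u (q%:E * leb (xsection E u)))%E.
  rewrite ge0_integralZl//.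
  exact: measurable_fun_xsection.
apply: ge0_le_integral => //.
- by move=> u _; exact: integral_ge0.
- exact: (measurable_fun_fubini_tonelli_F (m2 := @lebesgue_measure R) H mH H0).
- by apply: measurable_funeM; exact: measurable_fun_xsection.
move=> u _; rewrite integral_patch_xsection.
have mS : measurable (xsection E'' u) by exact: measurable_xsection.
rewrite [leLHS](_ : _ = (q * u)%:E * leb (xsection E'' u))%E; last first.
  by rewrite -integral_cst.
have [u0|u0] := leP u 0.
  rewrite (_ : xsection E'' u = set0) ?measure0 ?mule0 ?mule_ge0//.
  rewrite -subset0 => y; rewrite /xsection/= inE => -[/=].
  by rewrite ltNge u0.
(* For fixed [u > 0], the factor [u] is absorbed by passing from [t] to [u t], the second coordinate
   in [E]. *)
rewrite EFinM -muleA; apply: lee_wpmul2l; first by rewrite lee_fin.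
apply: le_trans (lebesgue_scale_le _ _ u0 _); last exact: measurable_xsection.
apply: lee_wpmul2l; first by rewrite lee_fin ltW.
apply: le_lebesgue => y; rewrite /xsection/= inE => -[_ /= Ey].
by rewrite inE.
Qed.

(** * The folding of the imaginary axis onto one period segment *)

(** The representative of [y] modulo [4 sqrt 2] in [[- sqrt 2, 3 sqrt 2)]. Folding it at [sqrt 2]
    gives the triangle wave [zorich_wave]. *)
Definition zorich_phase {R : realType} (y : R) : R :=
  y - 4 * (Num.floor ((y / sq2 R + 1) / 4))%:~R * sq2 R.

Definition zorich_wave {R : realType} (y : R) : R :=
  if zorich_phase y <= sq2 R then zorich_phase y else 2 * sq2 R - zorich_phase y.

Lemma zorich_gE {R : realType} (h1 h3 : R * R -> R) (lambda nu : R) :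
  zorich_g h1 h3 lambda nu =
  (fun z => (nu * expR (lambda * z.1) * za h3 (zorich_wave z.2),
             nu * expR (lambda * z.1) * zb h1 (zorich_wave z.2))).
Proof. exact/funext. Qed.

Lemma sq2_gt0 {R : realType} : 0 < sq2 R.
Proof. by rewrite sqrtr_gt0. Qed.

Lemma sqr_sq2 {R : realType} : sq2 R ^+ 2 = 2.
Proof. by rewrite sqr_sqrtr. Qed.

Lemma zorich_phase_itv {R : realType} (y : R) :
  - sq2 R <= zorich_phase y < 3 * sq2 R.
Proof.
have s0 := @sq2_gt0 R.
rewrite /zorich_phase.
have := floor_itv ((y / sq2 R + 1) / 4).
set k := (Num.floor _)%:~R => /andP[].
rewrite intrD -/k ler_pdivlMr// ltr_pdivrMr// -lerBlDr -ltrBrDr.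
rewrite ler_pdivlMr// ltr_pdivrMr// => k1 k2.
by apply/andP; split; nra.
Qed.

Lemma zorich_wave_abs {R : realType} (y : R) :
  zorich_wave y = sq2 R - `|zorich_phase y - sq2 R|.
Proof.
rewrite /zorich_wave; case: (leP (zorich_phase y)) => h.
  by rewrite ler0_norm ?subr_le0//; lra.
by rewrite gtr0_norm ?subr_gt0//; lra.
Qed.

Lemma zorich_wave_itv {R : realType} (y : R) :
  - sq2 R <= zorich_wave y <= sq2 R.
Proof.
have /andP[? ?] := zorich_phase_itv y; rewrite /zorich_wave.
by case: (leP (zorich_phase y)) => ?; apply/andP; split; lra.
Qed.

Lemma ltz_intr {R : realType} (k j : int) : k < j -> k%:~R + 1 <= j%:~R :> R.
Proof. by move=> kj; rewrite -(intrD _ k 1) ler_int lezD1. Qed.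

(** The wave is the maximum of the tents with peaks at [sqrt 2 + 4 j sqrt 2]: the floor picks the
    peak nearest to [y], and any other peak is at distance at least [2 sqrt 2]. *)
Lemma zorich_wave_ge {R : realType} (y : R) (j : int) :
  sq2 R - `|y - sq2 R - 4 * j%:~R * sq2 R| <= zorich_wave y.
Proof.
rewrite zorich_wave_abs lerD2l lerN2.
have s0 := @sq2_gt0 R.
have := zorich_phase_itv y; rewrite /zorich_phase.
set k := Num.floor _ => /andP[k1 k2].
move: k1 k2; have [kj|jk|->] := ltrgtP k j => k1 k2; last by rewrite addrAC.
- have kj' := @ltz_intr R _ _ kj.
  have : 0 <= (j%:~R - k%:~R - 1) * sq2 R by rewrite mulr_ge0 ?(ltW s0)//; lra.
  move=> H; apply: (@le_trans _ _ (2 * sq2 R)); first by rewrite ler_norml; apply/andP; split; nra.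
  by rewrite -normrN; apply: le_trans (ler_norm _); nra.
- have kj' := @ltz_intr R _ _ jk.
  have : 0 <= (k%:~R - j%:~R - 1) * sq2 R by rewrite mulr_ge0 ?(ltW s0)//; lra.
  move=> H; apply: (@le_trans _ _ (2 * sq2 R)); first by rewrite ler_norml; apply/andP; split; nra.
  by apply: le_trans (ler_norm _); nra.
Qed.

(** A maximum of 1-Lipschitz tents: the tent attaining the wave at [u] bounds it from below at
    [v]. *)
Lemma zorich_wave_lipschitz {R : realType} (y z : R) :
  `|zorich_wave y - zorich_wave z| <= `|y - z|.
Proof.
suff H (u v : R) : zorich_wave u <= zorich_wave v + `|u - v|.
  have := H y z; have := H z y; rewrite [`|z - y|]distrC => h1 h2.
  by rewrite ler_norml; lra.
set k := Num.floor ((u / sq2 R + 1) / 4).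
have := zorich_wave_ge v k; rewrite (zorich_wave_abs u) /zorich_phase -/k.
rewrite [u - _ * sq2 R - _]addrAC.
have := ler_normD (u - sq2 R - 4 * k%:~R * sq2 R) (v - u).
have -> : u - sq2 R - 4 * k%:~R * sq2 R + (v - u) = v - sq2 R - 4 * k%:~R * sq2 R.
  by ring.
by rewrite [`|v - u|]distrC; lra.
Qed.

(** These lines lie midway between consecutive folds, at phase [0] for even [m] and [2 sqrt 2] for
    odd [m]. *)
Lemma zorich_wave_even {R : realType} (m : int) :
  zorich_wave (2 * sq2 R * m%:~R) = 0.
Proof.
have s0 := @sq2_gt0 R.
(* For [y = 2 sqrt 2 m], [y / sqrt 2 + 1 = 2 m + 1], so [e] is the residue of [2 m + 1] modulo 4,
   namely 1 or 3. *)
have phaseE (k : int) (e : R) : 0 <= e < 4 ->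
    2 * m%:~R + 1 = 4 * k%:~R + e ->
    zorich_phase (2 * sq2 R * m%:~R) = (e - 1) * sq2 R.
  move=> e04 mk; rewrite /zorich_phase (_ : Num.floor _ = k).
    have -> : m%:~R = (4 * k%:~R + e - 1) / 2 :> R by rewrite -mk; field.
    by field.
  apply: floor_def; rewrite intrD.
  have -> : (2 * sq2 R * m%:~R / sq2 R + 1) / 4 = k%:~R + e / 4.
    transitivity ((2 * m%:~R + 1) / 4 : R); first by field; rewrite gt_eqF.
    by rewrite mk; field.
  by move: e04 => /andP[? ?]; apply/andP; split; lra.
have := divz_eq m 2; have := modz_ge0 m (isT : 2%Z != 0); have := ltz_pmod m (isT : 0 < 2%Z).
set k := (m %/ 2)%Z; set d := (m %% 2)%Z => d2 d0 mE.
have {d0 d2} [d_|d_] : d = 0 \/ d = 1 by lia.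
  rewrite /zorich_wave (@phaseE k 1); first by rewrite subrr mul0r ltW.
    by lra.
  by rewrite mE d_ addr0 intrM; ring.
rewrite /zorich_wave (@phaseE k 3); first last.
- by rewrite mE d_ intrD intrM; ring.
- by lra.
by case: leP; lra.
Qed.

(** Phases on one branch differ by at most [2 sqrt 2]. Their difference equals [y - z] modulo
    [4 sqrt 2], hence exactly, and each branch of the fold has slope 1 or -1. *)
Lemma zorich_wave_isometry {R : realType} (y z : R) : `|y - z| < 2 * sq2 R ->
  (zorich_phase y <= sq2 R) = (zorich_phase z <= sq2 R) ->
  (zorich_wave y - zorich_wave z) ^+ 2 = (y - z) ^+ 2.
Proof.
move=> yz; have s0 := @sq2_gt0 R.
have kE : `|zorich_phase y - zorich_phase z| <= 2 * sq2 R ->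
    zorich_phase y - zorich_phase z = y - z.
  rewrite /zorich_phase.
  set k := Num.floor _; set j := Num.floor _ => H.
  suff -> : k = j by ring.
  have [kj|jk|//] := ltrgtP k j.
  - have kj' := @ltz_intr R _ _ kj.
    have : 0 <= (j%:~R - k%:~R - 1) * sq2 R by rewrite mulr_ge0 ?(ltW s0)//; lra.
    by move: yz H; rewrite ltr_norml ler_norml => /andP[? ?] /andP[? ?] ?; exfalso; nra.
  - have kj' := @ltz_intr R _ _ jk.
    have : 0 <= (k%:~R - j%:~R - 1) * sq2 R by rewrite mulr_ge0 ?(ltW s0)//; lra.
    by move: yz H; rewrite ltr_norml ler_norml => /andP[? ?] /andP[? ?] ?; exfalso; nra.
have /andP[y1 y2] := zorich_phase_itv y; have /andP[z1 z2] := zorich_phase_itv z.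
rewrite /zorich_wave; case: (leP (zorich_phase y)) => hy; case: (leP (zorich_phase z)) => hz // _.
  by rewrite kE// ler_norml; lra.
rewrite -kE; first by ring.
by rewrite ler_norml; lra.
Qed.

Lemma measurable_zorich_phase {R : realType} :
  measurable_fun setT (@zorich_phase R).
Proof.
apply: measurable_funB => //; apply: measurable_funM => //.
apply: measurable_funM => //.
apply: nondecreasing_measurable => // x y xy.
rewrite ler_int; apply: Num.Theory.le_floor.
by rewrite ler_pM2r// lerD2r ler_pM2r// invr_gt0 sq2_gt0.
Qed.

(** * The arc traced by the diagonal, and regularity of [g] *)

Lemma lipschitz_continuous {R : realType} (f : R -> R) (M : R) :
  (forall y z, (f y - f z) ^+ 2 <= M ^+ 2 * (y - z) ^+ 2) -> continuous f.
Proof.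
move=> fM y; apply/cvgrPdist_le => e e0.
have M1 : 0 < `|M| + 1 by rewrite ltr_pwDr.
near=> z.
have -> : `|f y - f z| = Num.sqrt ((f y - f z) ^+ 2) by rewrite sqrtr_sqr.
apply: le_trans (ler_wsqrtr (fM y z)) _.
rewrite -exprMn sqrtr_sqr normrM.
apply: (@le_trans _ _ ((`|M| + 1) * `|y - z|)).
  by rewrite ler_wpM2r// lerDl.
rewrite mulrC -ler_pdivlMr//.
near: z.
by apply: (@cvgr_dist_le _ _ _ (nbhs y) _ id y) => //; rewrite divr_gt0.
Unshelve. all: by end_near. Qed.

Section admissible.
Context {R : realType}.
Variables (L : R) (h1 h2 h3 : R * R -> R).
Hypothesis hL : admissible_h L h1 h2 h3.

Let diag_Qsq (w : R) : - sq2 R <= w <= sq2 R -> Qsq (w / sq2 R, w / sq2 R).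
Proof.
have s0 := @sq2_gt0 R.
by move=> /andP[w1 w2]; rewrite /Qsq/= ler_pdivlMr// ler_pdivrMr// mulN1r mul1r w1 w2.
Qed.

Let diag_h12 (w : R) : - sq2 R <= w <= sq2 R ->
  h1 (w / sq2 R, w / sq2 R) = h2 (w / sq2 R, w / sq2 R).
Proof.
move=> /diag_Qsq [/= w1 _]; case: hL => _ [_ [_ [_ [_ H]]]].
by have [] := H _ w1.
Qed.

Lemma za_zb_circle (w : R) : - sq2 R <= w <= sq2 R ->
  0 <= za h3 w /\ za h3 w ^+ 2 + zb h1 w ^+ 2 = 1.
Proof.
move=> wI; case: hL => _ [_ [im _]].
have : hemisphere (hmap h1 h2 h3 (w / sq2 R, w / sq2 R)).
  by rewrite -im; exists (w / sq2 R, w / sq2 R) => //; exact: diag_Qsq.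
rewrite /hemisphere /hmap/= -diag_h12// => -[sum1 h3_ge0]; split => //.
by rewrite /za /zb exprMn sqr_sq2; apply: etrans sum1; ring.
Qed.

(** Both [w |-> (w / sqrt 2, w / sqrt 2)] and, on the plane [x1 = x2], [x |-> (x3, sqrt 2 x1)] are
    isometries, so [L] carries over. The first bound gives the expansion of [g], the second its
    continuity. *)
Lemma za_zb_bilipschitz (v w : R) : - sq2 R <= v <= sq2 R -> - sq2 R <= w <= sq2 R ->
  (v - w) ^+ 2 <= L ^+ 2 * ((za h3 v - za h3 w) ^+ 2 + (zb h1 v - zb h1 w) ^+ 2) /\
  (za h3 v - za h3 w) ^+ 2 + (zb h1 v - zb h1 w) ^+ 2 <= L ^+ 2 * (v - w) ^+ 2.
Proof.
move=> vI wI; case: hL => L1 [bil _].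
have L0 : 0 < L by exact: lt_le_trans L1.
have /andP[] := bil _ _ (diag_Qsq _ vI) (diag_Qsq _ wI).
have s0 := @sq2_gt0 R.
have -> : dist2 (v / sq2 R, v / sq2 R) (w / sq2 R, w / sq2 R) = `|v - w|.
  rewrite /dist2/= -sqrtr_sqr; congr Num.sqrt.
  transitivity ((v - w) ^+ 2 * (2 / sq2 R ^+ 2)); first by field; rewrite gt_eqF.
  by rewrite sqr_sq2 divff// mulr1.
rewrite /dist3 /hmap/= -!diag_h12//.
have -> : (h1 (v / sq2 R, v / sq2 R) - h1 (w / sq2 R, w / sq2 R)) ^+ 2 +
   (h1 (v / sq2 R, v / sq2 R) - h1 (w / sq2 R, w / sq2 R)) ^+ 2 +
   (h3 (v / sq2 R, v / sq2 R) - h3 (w / sq2 R, w / sq2 R)) ^+ 2 =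
   (za h3 v - za h3 w) ^+ 2 + (zb h1 v - zb h1 w) ^+ 2.
  by rewrite /za /zb -mulrBr exprMn sqr_sq2; ring.
set S := (za h3 v - za h3 w) ^+ 2 + (zb h1 v - zb h1 w) ^+ 2.
have S0 : 0 <= S by rewrite addr_ge0// sqr_ge0.
rewrite ler_pdivrMr// => d1 d2.
rewrite -(real_normK (num_real (v - w))) -(sqr_sqrtr S0) -!exprMn.
split; rewrite ler_sqr ?nnegrE ?mulr_ge0 ?sqrtr_ge0 ?(ltW L0)//.
by rewrite mulrC.
Qed.

(** The two diagonals meet at the centre, where [h1 = h2] and [h1 = - h2]. *)
Lemma zb0 : zb h1 0 = 0.
Proof.
case: hL => _ [_ [_ [_ [_ H]]]].
have [] := H 0 _; first by rewrite lerN10 ler01.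
rewrite oppr0 /zb mul0r => -> h20.
have -> : h2 (0, 0) = 0 by lra.
by rewrite mulr0.
Qed.

Lemma za_zb_wave_continuous :
  continuous (fun y => za h3 (zorich_wave y)) /\ continuous (fun y => zb h1 (zorich_wave y)).
Proof.
have H y z : (za h3 (zorich_wave y) - za h3 (zorich_wave z)) ^+ 2 +
    (zb h1 (zorich_wave y) - zb h1 (zorich_wave z)) ^+ 2 <= L ^+ 2 * (y - z) ^+ 2.
  have [_ /le_trans] := za_zb_bilipschitz _ _ (zorich_wave_itv y) (zorich_wave_itv z).
  apply; rewrite ler_wpM2l ?sqr_ge0//.
  rewrite -(real_normK (num_real (y - z))) -[leLHS]real_normK ?num_real//.
  by rewrite ler_sqr ?nnegrE// zorich_wave_lipschitz.
split; apply: (@lipschitz_continuous _ _ L) => y z; apply: le_trans (H y z).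
  by rewrite lerDl sqr_ge0.
by rewrite lerDr sqr_ge0.
Qed.

Lemma zorich_g_continuous (lambda nu : R) :
  continuous (zorich_g h1 h3 lambda nu).
Proof.
have [ca cb] := za_zb_wave_continuous.
have cr : continuous (fun z : R * R => nu * expR (lambda * z.1)).
  move=> z; apply: cvgM; first exact: cvg_cst.
  apply: continuous_comp; last exact: continuous_expR.
  by apply: cvgM; [exact: cvg_cst|exact: cvg_fst].
have cf (f : R -> R) : continuous f ->
    continuous (fun z : R * R => nu * expR (lambda * z.1) * f z.2).
  move=> cf z; apply: cvgM; first exact: cr.
  by apply: (@continuous_comp _ _ _ snd f); [exact: cvg_snd|exact: cf].
rewrite zorich_gE => z; exact: (cvg_pair (cf _ ca z) (cf _ cb z)).
Qed.

Lemma zorich_g_measurable (lambda nu : R) :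
  measurable_fun setT (zorich_g h1 h3 lambda nu).
Proof.
have [ca cb] := za_zb_wave_continuous.
have mr : measurable_fun setT (fun z : R * R => nu * expR (lambda * z.1)).
  apply: (@measurableT_comp _ _ _ _ _ _ (fun x => nu * expR (lambda * x)));
    last exact: measurable_fst.
  by apply: measurable_funM => //; apply: measurableT_comp => //; exact: measurable_funM.
have mab (f : R -> R) : continuous f ->
    measurable_fun setT (fun z : R * R => nu * expR (lambda * z.1) * f z.2).
  move=> cf; apply: measurable_funM => //.
  apply: (@measurableT_comp _ _ _ _ _ _ f); last exact: measurable_snd.
  exact: continuous_measurable_fun.
by rewrite zorich_gE; apply: measurable_fun_pair; [exact: (mab _ ca)|exact: (mab _ cb)].
Qed.

Lemma zorich_g_real (lambda nu x : R) (m : int) :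
  (zorich_g h1 h3 lambda nu (x, 2 * sq2 R * m%:~R)).2 = 0.
Proof. by rewrite zorich_gE/= zorich_wave_even zb0 mulr0. Qed.

(** The imaginary parts of [S] form an interval containing no [2 sqrt 2 m], since [g] maps those
    lines into the real axis; hence it stays between two consecutive such values. *)
Lemma connected_strip (lambda nu : R) (S : set (R * R)) : connected S ->
  (forall z, S z -> (zorich_g h1 h3 lambda nu z).2 != 0) ->
  exists c, forall z, S z -> c <= z.2 < c + 2 * sq2 R.
Proof.
move=> cS S0; have s0 := @sq2_gt0 R.
have [->|/set0P[z0 Sz0]] := eqVneq S set0; first by exists 0.
have /connected_intervalP itvS : connected (snd @` S).
  apply: connected_continuous_connected => //.
  by apply: continuous_subspaceT => z; exact: cvg_snd.
have Sm z m : S z -> z.2 != 2 * sq2 R * m%:~R.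
  move=> Sz; apply/eqP => z2; have := S0 _ Sz.
  by rewrite [z]surjective_pairing z2 zorich_g_real eqxx.
have /andP[m1 m2] := floor_itv (z0.2 / (2 * sq2 R)).
move: m1 m2; set m := Num.floor _.
rewrite ler_pdivlMr ?mulr_gt0// ltr_pdivrMr ?mulr_gt0// => m1 m2.
exists (2 * sq2 R * m%:~R) => z Sz; apply/andP; split.
- rewrite leNgt; apply/negP => zm.
  have [] := itvS z.2 z0.2 _ _ (2 * sq2 R * m%:~R).
  + by exists z.
  + by exists z0.
  + by rewrite (ltW zm) mulrC.
  + by move=> y Sy /eqP; apply/negP; exact: Sm.
- rewrite ltNge; apply/negP => zm.
  have [] := itvS z0.2 z.2 _ _ (2 * sq2 R * (m + 1)%:~R).
  + by exists z0.
  + by exists z.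
  + rewrite mulrC (ltW m2)/= intrD mulrDl mul1r; apply: le_trans zm.
    by rewrite [_ * m%:~R]mulrC.
  + by move=> y Sy /eqP; apply/negP; exact: Sm.
Qed.

End admissible.

(** * Area estimates for [g] and its iterates *)

Lemma leb2_le {R : realType} (A B : set (R * R)) :
  measurable A -> measurable B -> A `<=` B -> (leb2 A <= leb2 B)%E.
Proof. by move=> mA mB AB; rewrite /leb2 le_measure ?inE. Qed.

Section contraction.
Context {R : realType}.
Variables (L lambda nu : R) (h1 h2 h3 : R * R -> R).
Hypotheses (hL : admissible_h L h1 h2 h3) (lambda1 : 1 <= lambda) (nu0 : 0 < nu).

Local Notation g := (zorich_g h1 h3 lambda nu).
Local Notation strip c := (`[c, c + 2 * sq2 R[%classic : set R).

Let la0 : 0 < lambda. Proof. exact: lt_le_trans lambda1. Qed.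
Let L0 : 0 < L. Proof. by case: hL => L1 _; exact: lt_le_trans L1. Qed.
Let mg : measurable_fun setT g. Proof. exact: zorich_g_measurable hL _ _. Qed.

(* Reflection in the line where the strip is folded makes [g] two-to-one on it. *)
Lemma zorich_contraction (c x0 : R) (E : set (R * R)) : measurable E ->
  (leb2 [set z | [/\ (x0 <= z.1)%R, strip c z.2 & E (g z)]] <=
   (2 * L / (lambda * nu ^+ 2 * expR (lambda * x0) ^+ 2))%:E * leb2 E)%E.
Proof.
move=> mE.
pose P := [set y | @zorich_phase R y <= sq2 R].
have mP : measurable P.
  rewrite (_ : P = setT `&` zorich_phase @^-1` `]-oo, sq2 R]); last first.
    by apply/seteqP; split => y /=; rewrite in_itv/= => // -[].
  by apply: measurable_zorich_phase.
have [ca cb] := za_zb_wave_continuous _ _ _ _ hL.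
(* On the part of the strip in one branch the fold preserves distances, so the polar estimate
   applies with [K = L]. The half-open strip supplies the strict bound [|y - z| < 2 sqrt 2]. *)
have half (D : set R) : measurable D ->
    (forall y z, (strip c `&` D) y -> (strip c `&` D) z -> P y <-> P z) ->
    (leb2 [set z | [/\ (x0 <= z.1)%R, (strip c `&` D) z.2 & E (g z)]] <=
   (L / (lambda * nu ^+ 2 * expR (lambda * x0) ^+ 2))%:E * leb2 E)%E.
  move=> mD PD.
  apply: (@polar_contraction _ (fun y => za h3 (zorich_wave y))
    (fun y => zb h1 (zorich_wave y))) => //.
  - exact: ltW.
  - by move=> y _; exact: (za_zb_circle _ _ _ _ hL _ (zorich_wave_itv y)).
  - move=> y z Dy Dz.
    rewrite -(@zorich_wave_isometry _ y z).
    + by have [] := za_zb_bilipschitz _ _ _ _ hL _ _ (zorich_wave_itv y) (zorich_wave_itv z).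
    + move: Dy Dz => [] /=; rewrite !in_itv/= => /andP[y1 y2] _ [/andP[z1 z2] _].
      by rewrite ltr_norml; apply/andP; split; lra.
    + by have [H1 H2] := PD _ _ Dy Dz; apply/idP/idP.
  - exact: measurableI.
  - exact: continuous_measurable_fun.
  - exact: continuous_measurable_fun.
have mW (D : set R) : measurable D ->
    measurable [set z : R * R | [/\ (x0 <= z.1)%R, (strip c `&` D) z.2 & E (g z)]].
  by move=> mD; apply: measurable_window => //; exact: measurableI.
have mP' : measurable (~` P) by exact: measurableC.
apply: (@le_trans _ _ (leb2 ([set z | [/\ (x0 <= z.1)%R, (strip c `&` P) z.2 & E (g z)]] `|`
   [set z | [/\ (x0 <= z.1)%R, (strip c `&` ~` P) z.2 & E (g z)]]))).
  apply: leb2_le; first exact: measurable_window.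
    by apply: measurableU; exact: mW.
  by move=> z [z1 z2 z3]; have [Pz|Pz] := pselect (P z.2); [left|right].
rewrite /leb2; apply: le_trans (measureU2 _ _ _) _; [exact: mW|exact: mW|].
apply: le_trans (leeD (half P mP _) (half _ mP' _)) _.
- by move=> y z [_ ?] [_ ?]; split.
- by move=> y z [_ ?] [_ ?]; split.
rewrite -ge0_muleDl ?lee_fin; last 2 first.
- by rewrite divr_ge0 ?mulr_ge0 ?sqr_ge0 ?(ltW la0) ?(ltW L0) ?(ltW nu0).
- by rewrite divr_ge0 ?mulr_ge0 ?sqr_ge0 ?(ltW la0) ?(ltW L0) ?(ltW nu0).
rewrite -EFinD (_ : L / _ + _ = 2 * L / (lambda * nu ^+ 2 * expR (lambda * x0) ^+ 2))//.
by rewrite -mulrDl; congr (_ / _); ring.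
Qed.

Lemma zorich_g_fst (z : R * R) : 0 <= (g z).1 <= nu * expR (lambda * z.1).
Proof.
rewrite zorich_gE/=.
have [a0 ab] := za_zb_circle _ _ _ _ hL _ (zorich_wave_itv z.2).
have r0 : 0 <= nu * expR (lambda * z.1) by rewrite mulr_ge0 ?expR_ge0 ?ltW.
apply/andP; split; first by rewrite mulr_ge0.
rewrite ler_piMr// -(@expr_le1 _ 2)// -ab lerDl.
exact: sqr_ge0.
Qed.

(* Where [j <= x < j + 1], [g] expands area by a factor of order [expR (2 lambda j)]
   while its image lies in a rectangle of area of order [expR (lambda j)]. *)
Lemma zorich_return_area : exists M : R, forall c c' : R,
  (leb2 [set z | [/\ (0 <= z.1)%R, strip c z.2 & strip c' (g z).2]] <= M%:E)%E.
Proof.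
have s0 := @sq2_gt0 R.
pose e := expR lambda.
have e2 : 2 <= e.
  by have := lambda1; have := expR_ge1Dx lambda; rewrite -/e; lra.
have e0 : 0 < e by exact: expR_gt0.
have eE (j : nat) : expR (lambda * j%:R) = e ^+ j by rewrite mulrC expRM_natl.
(* The contraction factor for [x >= j] times the area of the rectangle [E j] is [C / e^j]. As
   [e >= 2], the series is dominated by that of [C / 2^j], with sum [2 C]. *)
pose C := 2 * L / (lambda * nu ^+ 2) * nu * e * (2 * sq2 R).
have C0 : 0 <= C.
  rewrite /C; apply: mulr_ge0; last by rewrite mulr_ge0 ?(ltW s0).
  apply: mulr_ge0; last exact: ltW.
  apply: mulr_ge0; last exact: ltW.
  by rewrite divr_ge0 ?mulr_ge0 ?sqr_ge0 ?(ltW la0) ?(ltW L0) ?(ltW nu0).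
exists (2 * C) => c c'.
pose E (j : nat) : set (R * R) :=
  `[0, nu * expR (lambda * j.+1%:R)]%classic `*` strip c'.
have mE j : measurable (E j) by exact: measurableX.
pose N (j : nat) := [set z | [/\ j%:R <= z.1, strip c z.2 & E j (g z)]].
have mN j : measurable (N j) by exact: measurable_window.
have mS : measurable [set z | [/\ 0 <= z.1, strip c z.2 & strip c' (g z).2]].
  apply: (measurable_window g 0 (strip c) [set z | strip c' z.2]) => //.
  by rewrite -[X in measurable X]setTI; apply: measurable_snd.
have NU : [set z | [/\ 0 <= z.1, strip c z.2 & strip c' (g z).2]] `<=` \bigcup_j N j.
  move=> z [z1 z2 z3]; exists (Num.trunc z.1) => //.
  have /andP[j1 j2] := truncn_itv z1.
  split => //; split => //=.
  have /andP[g0 g1] := zorich_g_fst z.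
  rewrite in_itv/= g0 (le_trans g1)// ler_wpM2l ?(ltW nu0)// ler_expR.
  by rewrite ler_pM2l// ltW.
have H := measure_sigma_subadditive (@lebesgue_measure R \x @lebesgue_measure R)%E mN mS NU.
apply: (le_trans H).
apply: (@le_trans _ _ (\sum_(0 <= j <oo) ((2 * C) / (2 ^ j.+1)%:R)%:E)%E); last first.
  by apply: epsilon_trick0; rewrite mulr_ge0.
apply: lee_nneseries => [j _ _|j _]; first exact: measure_ge0.
apply: (le_trans (zorich_contraction c j%:R (E j) (mE j))).
have -> : leb2 (E j) = (nu * e ^+ j.+1 * (2 * sq2 R))%:E.
  rewrite /leb2 product_measure1E/=; [|exact: measurable_itv|exact: measurable_itv].
  have r0 : 0 < nu * expR (lambda * j.+1%:R) by rewrite mulr_gt0// expR_gt0.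
  rewrite !lebesgue_measure_itv/= !lte_fin r0 ifT; last by rewrite ltrDl mulr_gt0.
  by rewrite -!EFinB -EFinM subr0 eE [c' + _]addrC addrK.
rewrite -EFinM lee_fin eE (exprS e).
have ej0 : 0 < e ^+ j by rewrite exprn_gt0.
rewrite [leLHS](_ : _ = C / e ^+ j); last first.
  by rewrite /C; field; rewrite ?gt_eqF ?exprn_gt0.
rewrite expnS natrM natrX invfM mulrACA divff// mul1r.
rewrite ler_wpM2l// lef_pV2 ?posrE ?exprn_gt0//.
by rewrite lerXn2r ?nnegrE ?(ltW e0).
Qed.

(** Induction pulls [E] back through the last application of [g], to [E2]. Only the first
    application starts from [x >= x0]; every later one starts from [x >= 0] and contributes the
    factor [2 L / (lambda nu^2)]. *)
Lemma zorich_iterate_area (A : set (R * R)) (c : nat -> R) (x0 : R) :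
  measurable A -> (forall z, A z -> x0 <= z.1) ->
  (forall n z, A z -> strip (c n) (iter n g z).2) ->
  forall n (E : set (R * R)), measurable E ->
  (leb2 (A `&` iter n.+1 g @^-1` E) <=
   (2 * L / (lambda * nu ^+ 2 * expR (lambda * x0) ^+ 2) *
    (2 * L / (lambda * nu ^+ 2)) ^+ n)%:E * leb2 E)%E.
Proof.
move=> mA Ax0 Ac n; elim: n => [|n IH] E mE.
  rewrite expr0 mulr1; apply: le_trans (zorich_contraction (c 0) x0 E mE).
  apply: leb2_le.
  - by apply: measurableI => //; rewrite -[X in measurable X]setTI; apply: mg.
  - by apply: measurable_window => //; exact: measurable_itv.
  - by move=> z [Az Ez]; split => //; [exact: Ax0|exact: (Ac 0%N z Az)].
have miter m : measurable_fun setT (iter m g).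
  elim: m => [|m IHm]; first exact: measurable_id.
  rewrite (_ : iter m.+1 g = g \o iter m g)//.
  exact: measurableT_comp mg IHm.
pose E2 := [set z | [/\ 0 <= z.1, strip (c n.+1) z.2 & E (g z)]].
have mE2 : measurable E2 by exact: measurable_window.
apply: (@le_trans _ _ (leb2 (A `&` iter n.+1 g @^-1` E2))).
  apply: leb2_le.
  - by apply: measurableI => //; rewrite -[X in measurable X]setTI; apply: miter.
  - by apply: measurableI => //; rewrite -[X in measurable X]setTI; apply: miter.
  - move=> z [Az Ez]; split => //; split => //.
      by have /andP[] := zorich_g_fst (iter n g z).
    exact: Ac.
apply: (le_trans (IH _ mE2)).
have q0 : 0 <= 2 * L / (lambda * nu ^+ 2).
  by rewrite divr_ge0 ?mulr_ge0 ?sqr_ge0 ?(ltW la0) ?(ltW L0) ?(ltW nu0).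
have := zorich_contraction (c n.+1) 0 E mE.
rewrite mulr0 expR0 expr1n mulr1; move: q0.
set q := 2 * L / (lambda * nu ^+ 2); set C := _ / _ => q0 E2E.
rewrite (exprSr q) mulrA [X in (_ <= X * _)%E]EFinM -muleA.
apply: lee_wpmul2l => //; rewrite lee_fin mulr_ge0 ?exprn_ge0//.
by rewrite divr_ge0 ?mulr_ge0 ?sqr_ge0 ?(ltW la0) ?(ltW L0) ?(ltW nu0).
Qed.

Lemma connected_iter (V : set (R * R)) (n : nat) : connected V ->
  connected (iter n g @` V).
Proof.
move=> cV; elim: n => [|n IH]; first by rewrite /= image_id.
rewrite (_ : iter n.+1 g = g \o iter n g)// -image_comp.
apply: connected_continuous_connected => //.
by apply: continuous_subspaceT; exact: (zorich_g_continuous _ _ _ _ hL).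
Qed.

End contraction.

(** * The contradiction between positive area and geometric decay *)

(** Countably many half-planes exhaust the plane. The lower bound on [x] makes the constant of the
    first application of [g] finite. *)
Lemma pos_leb2_half_plane {R : realType} (A : set (R * R)) : measurable A ->
  (0 < leb2 A)%E ->
  exists N : nat, (0 < leb2 (A `&` [set z | (- N%:R <= z.1)%R]))%E.
Proof.
move=> mA A0; apply: contrapT => /forallNP H.
have mN (N : nat) : measurable (A `&` [set z | - N%:R <= z.1]).
  by apply: measurableI => //; exact: measurable_half_plane.
have AU : A `<=` \bigcup_(N : nat) (A `&` [set z | - N%:R <= z.1]).
  move=> z Az; exists (Num.trunc `|z.1|).+1 => //; split => //=.
  rewrite lerNl; apply: (@le_trans _ _ `|z.1|).
    by rewrite -normrN ler_norm.
  exact/ltW/truncnS_gt.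
have := measure_sigma_subadditive (@lebesgue_measure R \x @lebesgue_measure R)%E mN mA AU.
rewrite eseries0; first by rewrite leNgt A0.
move=> N _ _; apply/eqP; rewrite eq_le measure_ge0 andbT leNgt; apply/negP.
exact: H.
Qed.

Theorem theorem3p1 (R : realType) (L lambda nu : R) (h1 h2 h3 : R * R -> R)
  (V : set (R * R)) :
  admissible_h L h1 h2 h3 ->
  1 <= lambda -> 0 < nu ->
  2 * L < nu ^+ 2 * lambda ->
  connected V -> pos_leb2_measure V ->
  exists n : nat, exists2 z, V z & (iter n (zorich_g h1 h3 lambda nu) z).2 = 0.
Proof.
move=> hL la1 nu0 Lnu cV [A [B [mA _ [AV _] _ A0]]].
set g := zorich_g h1 h3 lambda nu.
apply: contrapT => noreal.
(* The [n]-th image is confined to a strip because the next one, of index [n + 1], misses the real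
   axis. *)
have strips n : exists c, forall z, V z -> c <= (iter n g z).2 < c + 2 * sq2 R.
  have [|z [y Vy <-]|c Hc] := connected_strip _ _ _ _ hL lambda nu (iter n g @` V).
  - exact: (connected_iter _ _ _ _ _ _ hL).
  - by apply/eqP => z0; apply: noreal; exists n.+1; exists y.
  - by exists c => z Vz; apply: Hc; exists z.
have [c Hc] := choice strips.
have [N AN0] := pos_leb2_half_plane A mA A0.
set A' := A `&` _ in AN0.
have mA' : measurable A'.
  by apply: measurableI => //; exact: measurable_half_plane.
have A'c n z : A' z -> `[c n, c n + 2 * sq2 R[%classic (iter n g z).2.
  by move=> [Az _]; rewrite /= in_itv/=; apply: Hc; exact: AV.
have la0 : 0 < lambda by exact: lt_le_trans la1.
have L0 : 0 < L by case: hL => L1 _; exact: lt_le_trans L1.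
have [M HM] := zorich_return_area _ _ _ _ _ _ hL la1 nu0.
set q := 2 * L / (lambda * nu ^+ 2).
have q0 : 0 <= q by rewrite divr_ge0 ?mulr_ge0 ?sqr_ge0 ?(ltW la0) ?(ltW L0) ?(ltW nu0).
(* This is the hypothesis [nu^2 lambda > 2 L]. *)
have q1 : q < 1 by rewrite ltr_pdivrMr ?mulr_gt0 ?exprn_gt0// mul1r [ltRHS]mulrC.
set C := 2 * L / (lambda * nu ^+ 2 * expR (lambda * - N%:R) ^+ 2).
have C0 : 0 <= C by rewrite divr_ge0 ?mulr_ge0 ?sqr_ge0 ?(ltW la0) ?(ltW L0) ?(ltW nu0).
have mg : measurable_fun setT g by exact: (zorich_g_measurable _ _ _ _ hL).
have gf z : 0 <= (g z).1.
  by have /andP[] := zorich_g_fst _ lambda _ _ _ _ hL nu0 z.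
have bound n : (leb2 A' <= (C * q ^+ n * M)%:E)%E.
  (* [E] contains the image of [A'] under [g^(n+1)] and has area at most [M] whatever the two strips
     are; so all of [A'] is a preimage of a set of bounded area. *)
  pose E := [set z | [/\ 0 <= z.1, `[c n.+1, c n.+1 + 2 * sq2 R[%classic z.2 &
     `[c n.+2, c n.+2 + 2 * sq2 R[%classic (g z).2]].
  have mE : measurable E.
    apply: (measurable_window g 0 _ [set z | `[c n.+2, c n.+2 + 2 * sq2 R[%classic z.2]) => //.
    by rewrite -[X in measurable X]setTI; apply: measurable_snd.
  have -> : A' = A' `&` iter n.+1 g @^-1` E.
    apply/esym/setIidPl => z A'z; split.
    - exact: gf.
    - exact: (A'c n.+1).
    - exact: (A'c n.+2).
  apply: (le_trans (zorich_iterate_area _ _ _ _ _ _ hL la1 nu0 A' c (- N%:R) mA' _ A'c n E mE)).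
    by move=> z [].
  rewrite (EFinM _ M); apply: lee_wpmul2l; last exact: HM.
  by rewrite lee_fin mulr_ge0 ?exprn_ge0.
have Afin : leb2 A' \is a fin_num.
  by rewrite ge0_fin_numE ?measure_ge0// (le_lt_trans (bound 0%N))// ltry.
have r0 : 0 < fine (leb2 A').
  by rewrite fine_gt0// AN0/= (le_lt_trans (bound 0%N))// ltry.
have cv : C * q ^+ n * M @[n --> \oo] --> (0 : R).
  rewrite -(mul0r M) -(mulr0 C); apply: cvgM; last exact: cvg_cst.
  apply: cvgM; first exact: cvg_cst.
  by apply: cvg_expr; rewrite ger0_norm.
(* The bounds tend to 0, so one of them falls below the positive area of [A']. *)
have [n _ /(_ n (leqnn n))] := cvgr_lt _ cv _ r0.
apply/negP; rewrite -leNgt -lee_fin fineK//.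
Qed.
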